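(* Let $N\ge 1$, let $\lambda=(\lambda_1\ge\lambda_2\ge\cdots\ge\lambda_N)$ be a signature of size $N$, and let $x$ be a complex number other than $0$ and $1$. Then $$S_\lambda(x;N,1)=\frac{(N-1)!}{(x-1)^{N-1}}\,\frac{1}{2\pi \mathbf{i}}\oint_C \frac{x^z}{\prod_{i=1}^N\bigl(z-(\lambda_i+N-i)\bigr)}\,dz,$$ where $C$ is a (positively oriented) contour enclosing all the singularities of the integrand.
   Context: A signature of size $N$ is an $N$-tuple of integers $\lambda_1\ge\cdots\ge\lambda_N$. The rational Schur function is the symmetric Laurent polynomial $$s_\lambda(u_1,\dots,u_N)=\frac{\det\bigl[u_i^{\lambda_j+N-j}\bigr]_{i,j=1}^N}{\prod_{i<j}(u_i-u_j)}$$ (extended to coinciding arguments as a Laurent polynomial). Its normalized version is $$S_\lambda(x_1,\dots,x_k;N,1)=\frac{s_\lambda(x_1,\dots,x_k,\overbrace{1,\dots,1}^{N-k})}{s_\lambda(\underbrace{1,\dots,1}_{N})}.$$ Here $x^z=\exp(z\ln x)$ for a fixed choice of $\ln x$, and $\mathbf{i}=\sqrt{-1}$. *)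

(* Defs.v *)
From HB Require Import structures.
From mathcomp Require Import all_boot all_order all_algebra finmap.
From mathcomp Require Import all_classical all_reals all_analysis.
From mathcomp Require Import complex.

Set Implicit Arguments.
Unset Strict Implicit.
Unset Printing Implicit Defensive.

Import Order.TTheory GRing.Theory Num.Theory.
Import numFieldNormedType.Exports.

Local Open Scope classical_set_scope.
Local Open Scope ring_scope.
Local Open Scope complex_scope.

Section Schur.
Variables (R : realType) (N : nat).

(* Indices are 0-based: [l i] is the classical l_(i+1). *)
Definition signature (l : 'I_N -> int) : Prop :=
  forall i j : 'I_N, (i <= j)%N -> l j <= l i.

Definition shifted (l : 'I_N -> int) (j : 'I_N) : int :=
  l j + (N - j.+1)%N%:Z.

(* Laurent polynomials in N variables, as finitely supported families of
   coefficients indexed by integer exponent vectors. *)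
Definition laurent : choiceType :=
  {fsfun {ffun 'I_N -> int} -> R[i] for (fun=> 0)}.

Definition laurent_eval (p : laurent) (u : 'I_N -> R[i]) : R[i] :=
  \sum_(m <- finsupp p) p m * \prod_(i < N) u i ^ m i.

Definition is_rational_schur (l : 'I_N -> int) (p : laurent) : Prop :=
  forall u : 'I_N -> R[i], (forall i, u i != 0) -> injective u ->
    laurent_eval p u =
      \det (\matrix_(i < N, j < N) u i ^ shifted l j) /
      \prod_(i < N) \prod_(j < N | (i < j)%N) (u i - u j).

(* For a signature [l] there is exactly one Laurent polynomial satisfying
   [is_rational_schur l]; the default value [fsfun] is then irrelevant. *)
Definition rational_schur (l : 'I_N -> int) : laurent :=
  xget [fsfun] [set p | is_rational_schur l p].

(* S_l(x_1, .., x_k; N, 1), meant for k <= N: [nth 1] pads x with ones. *)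
Definition normalized_schur (l : 'I_N -> int) (k : nat) (x : k.-tuple R[i])
    : R[i] :=
  laurent_eval (rational_schur l) (fun i => nth 1 x i) /
  laurent_eval (rational_schur l) (fun=> 1).

End Schur.

Section ComplexAnalysis.
Variable R : realType.
Implicit Types (g : R -> R[i]) (f : R[i] -> R[i]).

Definition cexp (z : R[i]) : R[i] :=
  (expR (complex.Re z))%:C * (cos (complex.Im z) +i* sin (complex.Im z)).

(* x ^ z, where lnx is the chosen logarithm of x. *)
Definition cpow (lnx z : R[i]) : R[i] := cexp (z * lnx).

Definition integral01 (h : R -> R[i]) : R[i] :=
  Rintegral lebesgue_measure `[0, 1] (@complex.Re R \o h) +i*
  Rintegral lebesgue_measure `[0, 1] (@complex.Im R \o h).

(* Where g is not differentiable (finitely many points of [0, 1] for the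
   curves considered here) the value is irrelevant to the integral. *)
Definition velocity g (t : R) : R[i] :=
  derive1 (@complex.Re R \o g) t +i* derive1 (@complex.Im R \o g) t.

Definition contour_integral g f : R[i] :=
  integral01 (fun t => f (g t) * velocity g t).

(* h' exists on ]a, b[ and extends continuously to [a, b]; continuity of h
   itself on [a, b] is required separately. *)
Definition C1_on (a b : R) (h : R -> R) : Prop :=
  exists2 h' : R -> R, {within `[a, b], continuous h'} &
    forall t, a < t < b -> is_derive t 1 h (h' t).

Definition piecewise_C1 g : Prop :=
  {within `[0, 1], continuous (g : R -> R[i]^o)} /\
  exists2 s : seq R, itv_partition 0 1 s &
    forall k, (k < size s)%N ->
      C1_on (nth 0 (0 :: s) k) (nth 0 (0 :: s) k.+1) (@complex.Re R \o g) /\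
      C1_on (nth 0 (0 :: s) k) (nth 0 (0 :: s) k.+1) (@complex.Im R \o g).

Definition simple_closed g : Prop :=
  g 0 = g 1 /\
  forall s t : R, 0 <= s < 1 -> 0 <= t < 1 -> g s = g t -> s = t.

Definition curve_image g : set R[i]^o := g @` `[0, 1].

(* [a] lies off the curve, in a bounded component of its complement. *)
Definition encloses g (a : R[i]) : Prop :=
  ~ curve_image g a /\
  exists M : R, forall z, connected_component (~` curve_image g) a z ->
    `|z| <= M%:C.

(* In polar coordinates centred at [a], the argument of g(t) increases by
   exactly 2 pi as t goes from 0 to 1. *)
Definition winds_once_counterclockwise g (a : R[i]) : Prop :=
  exists r theta : R -> R,
    [/\ {within `[0, 1], continuous r},
        {within `[0, 1], continuous theta},
        forall t, 0 <= t <= 1 -> 0 < r t /\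
          g t = a + (r t)%:C * (cos (theta t) +i* sin (theta t)) &
        theta 1 = theta 0 + 2 * pi].

Definition positively_oriented g : Prop :=
  forall a, encloses g a -> winds_once_counterclockwise g a.

Definition contour g : Prop :=
  [/\ piecewise_C1 g, simple_closed g & positively_oriented g].

End ComplexAnalysis.

(* Main.v *)
(** The normalized Schur function is evaluated by principal specialization.
With [a_j = lambda_j + N - j], multiplying [s_lambda] by the Vandermonde product
[prod_(i<j) (u_i - u_j)] gives [det (u_i^(a_j))].  At [u = (1, q, .., q^(N-1))]
this determinant is itself a Vandermonde determinant, in the [q^(a_j)]; at
[u = (x, 1, q, .., q^(N-2))] its expansion along the first row is a combination
of the [x^(a_j)] with such coefficients.  Cancelling powers of [q - 1] and setting
[q = 1] yields
  [S_lambda(x) = (N-1)! / (x-1)^(N-1) * sum_j x^(a_j) / prod_(i != j) (a_j - a_i)].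

By partial fractions the contour integral reduces to the integrals of
[exp (L (z - a)) / (z - a)], with [L = ln x].  Replacing [L] by [s L], the
derivative in [s] is the integral of [L exp (s L (z - a))], which vanishes
because the integrand has a primitive, so one may take [s = 0].  The remaining
integral of [1 / (z - a)] is [2 pi i], since [ln |z - a| + i theta] is a
primitive along the contour and the argument [theta] increases by [2 pi]. *)

Require Import Defs.
From HB Require Import structures.
From mathcomp Require Import all_boot all_order all_algebra finmap.
From mathcomp Require Import all_classical all_reals all_analysis.
From mathcomp Require Import complex.
From mathcomp Require Import (canonicals, coercions) mpoly.
From mathcomp Require Import zify ring lra.

Set Implicit Arguments.
Unset Strict Implicit.
Unset Printing Implicit Defensive.

Import Order.TTheory GRing.Theory Num.Theory.
Import numFieldNormedType.Exports.

Local Open Scope classical_set_scope.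
Local Open Scope ring_scope.
Local Open Scope complex_scope.

(** * Rational Schur functions *)

(** The orientation [u i - u j] for [i < j] is that of the denominator in [is_rational_schur],
    opposite to that of [det_Vandermonde]; hence the signs below. *)
Definition vdm (A : comPzRingType) (n : nat) (u : 'I_n -> A) : A :=
  \prod_(i < n) \prod_(j < n | (i < j)%N) (u i - u j).

Lemma vdm_neq0 (A : idomainType) n (u : 'I_n -> A) : injective u -> vdm u != 0.
Proof.
move=> ui; apply/prodf_neq0 => i _; apply/prodf_neq0 => j ij.
by rewrite subr_eq0; apply: contraTN ij => /eqP /ui ->; rewrite ltnn.
Qed.

Lemma det_Vandermonde_vdm (A : comNzRingType) (n : nat) (u : 'I_n -> A) :
  exists e : bool, \det (Vandermonde n (\row_i u i)) = (-1) ^+ e * vdm u.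
Proof.
rewrite det_Vandermonde /vdm.
pose k := (\sum_(i < n) \sum_(j < n | (i < j)%N) 1)%N.
exists (odd k); rewrite signr_odd /k expr_sum.
rewrite -big_split /=; apply: eq_bigr => i _.
rewrite expr_sum -big_split /=; apply: eq_bigr => j _.
by rewrite !mxE expr1 mulN1r opprB.
Qed.

(* Reducing the f_j modulo the monic polynomial prod_i (X - u_i) turns the
   matrix into a product of a Vandermonde matrix and a coefficient matrix. *)
Lemma vdm_dvd_det (A : comNzRingType) (n : nat) (u : 'I_n -> A)
    (f : 'I_n -> {poly A}) :
  exists g, \det (\matrix_(i < n, j < n) (f j).[u i]) = vdm u * g.
Proof.
pose w : {poly A} := \prod_(i < n) ('X - (u i)%:P).
have wm : w \is monic by apply: monic_prod_XsubC.
have sw : size w = n.+1 by rewrite /w size_prod_XsubC /index_enum -enumT size_enum_ord.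
pose r j := Pdiv.Ring.rmodp (f j) w.
have rs j : (size (r j) <= n)%N.
  by rewrite -ltnS -sw Pdiv.Ring.ltn_rmodpN0 // monic_neq0.
have [e He] := det_Vandermonde_vdm u.
exists ((-1) ^+ e * \det (\matrix_(k < n, j < n) (r j)`_k)).
rewrite mulrA [_ * (-1) ^+ e]mulrC -He -[X in X * _]det_tr -det_mulmx.
congr (\det _); apply/matrixP => i j; rewrite !mxE.
have wu : w.[u i] = 0.
  by rewrite /w horner_prod (bigD1 i) //= hornerXsubC subrr mul0r.
rewrite [f j](Pdiv.RingMonic.rdivp_eq wm) hornerD hornerM wu mulr0 add0r.
rewrite -/(r j) (horner_coef_wide _ (rs j)).
by apply: eq_bigr => k _; rewrite !mxE mulrC.
Qed.

(** * Existence of the rational Schur function as a Laurent polynomial *)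

Section Laurent.
Variables (R : realType) (N : nat).
Local Notation K := R[i].

Lemma laurent_eval_seq (s : seq (K * {ffun 'I_N -> int})) :
  exists p : laurent R N, forall u : 'I_N -> K,
    laurent_eval p u = \sum_(a <- s) a.1 * \prod_(i < N) u i ^ a.2 i.
Proof.
pose S : {fset {ffun 'I_N -> int}} := [fset m | m in map snd s]%fset.
pose p : laurent R N := [fsfun m in S => \sum_(a <- s | a.2 == m) a.1 | 0].
exists p => u; rewrite /laurent_eval.
have pE m : m \in S -> p m = \sum_(a <- s | a.2 == m) a.1.
  by move=> mS; rewrite fsfunE mS.
have sub : (finsupp p `<=` S)%fset by apply: finsupp_sub.
(* Terms with equal exponents may cancel, so the support of [p] is only contained in [S]; the
   additional summands vanish. *)
rewrite (big_fset_incl _ sub) /=; last first.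
  by move=> m _ /fsfun_dflt ->; rewrite mul0r.
transitivity (\sum_(m <- S) \sum_(a <- s | a.2 == m)
    a.1 * \prod_(i < N) u i ^ a.2 i).
  rewrite [LHS]big_seq [RHS]big_seq; apply: eq_bigr => m mS.
  by rewrite pE // mulr_suml; apply: eq_bigr => a /eqP ->.
rewrite (exchange_big_dep xpredT) //=.
rewrite [LHS]big_seq [RHS]big_seq; apply: eq_bigr => a ain.
rewrite -big_filter.
have -> : [seq m <- S | a.2 == m] = [:: a.2].
  have <- : seq.filter (pred1 a.2) S = [:: a.2].
    apply: filter_pred1_uniq; first exact: fset_uniq.
    by rewrite in_fset; apply/mapP; exists a.
  by apply: eq_filter => m /=; rewrite eq_sym.
by rewrite big_seq1.
Qed.

(** A common shift [M] makes all exponents nonnegative. By [vdm_dvd_det] with the variables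
    themselves as points, the Vandermonde product divides the determinant in the polynomial ring;
    the exponents of the quotient [g] are then shifted back by [M]. *)
Lemma rational_schur_exists (l : 'I_N -> int) :
  exists p : laurent R N, is_rational_schur l p.
Proof.
pose M := (\sum_j absz (shifted l j))%N.
have Mge j : 0 <= shifted l j + M%:Z.
  have : (absz (shifted l j) <= M)%N by rewrite /M (bigD1 j) //= leq_addr.
  rewrite -lez_nat abszE => h.
  by rewrite -lerBlDl sub0r (le_trans _ h) // -normrN ler_norm.
pose b j : nat := absz (shifted l j + M%:Z).
pose X (i : 'I_N) : mpoly.mpoly N K := mpoly.mpolyX K (mpoly.mnm1 i).
have [g Hg] := vdm_dvd_det X (fun j => 'X^(b j)).
pose s := [seq (mpoly.mcoeff m g, [ffun i => (m i)%:Z - M%:Z]) | m <- mpoly.msupp g].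
have [p Hp] := laurent_eval_seq s.
exists p => u u0 ui; rewrite Hp big_map /=.
have V0 : vdm u != 0 by exact: vdm_neq0.
apply: (canRL (mulfK V0)).
have : mpoly.meval u (vdm X * g) =
    \det (\matrix_(i < N, j < N) u i ^+ b j).
  rewrite -Hg -det_map_mx; congr (\det _); apply/matrixP => i j.
  by rewrite !mxE hornerXn rmorphXn /= mpoly.mevalXU.
rewrite rmorphM /=.
have -> : mpoly.meval u (vdm X) = vdm u.
  rewrite rmorph_prod; apply: eq_bigr => i _.
  rewrite rmorph_prod; apply: eq_bigr => j _.
  by rewrite rmorphB /= !mpoly.mevalXU.
have P0 : \prod_i u i ^+ M != 0 by apply/prodf_neq0 => i _; rewrite expf_neq0.
(* The shift pulls a factor [u i ^+ M] out of row [i], which is left multiplication by a diagonal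
   matrix. *)
have -> : \det (\matrix_(i < N, j < N) u i ^+ b j) =
    (\prod_i u i ^+ M) * \det (\matrix_(i < N, j < N) u i ^ shifted l j).
  have <- : \det (diag_mx (\row_i u i ^+ M)) = \prod_i u i ^+ M.
    by rewrite det_diag; apply: eq_bigr => i _; rewrite mxE.
  rewrite -det_mulmx; congr (\det _); apply/matrixP => i j.
  rewrite mul_diag_mx !mxE [u i ^+ b j]exprnP /b gez0_abs // addrC expfzDr //.
move=> Hd.
apply: (mulfI P0); rewrite -Hd mulrA [RHS]mulrC; congr (_ * _).
rewrite mulrC mpoly.mevalE mulr_suml.
apply: eq_bigr => m _; rewrite -mulrA -big_split /=; congr (_ * _).
apply: eq_bigr => i _.
by rewrite !exprnP -expfzDr // ffunE subrK.
Qed.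

Lemma rational_schurP (l : 'I_N -> int) :
  is_rational_schur l (rational_schur R l).
Proof.
rewrite /rational_schur; case: xgetP => [p _ //|noP].
by have [p /noP] := rational_schur_exists l.
Qed.

(** With the denominator cleared, coinciding coordinates are allowed: both sides then vanish. This
    matters for the specializations below, where powers of [q] may coincide with each other or with
    [x]. *)
Lemma rational_schur_vdm (l : 'I_N -> int) (u : 'I_N -> K) :
  (forall i, u i != 0) ->
  laurent_eval (rational_schur R l) u * vdm u =
    \det (\matrix_(i < N, j < N) u i ^ shifted l j).
Proof.
move=> u0; have [/injectiveP ui|/injectivePn [i [j ij uij]]] := boolP (injectiveb u).
  by rewrite rational_schurP // mulfVK //; exact: vdm_neq0.
rewrite (determinant_alternate ij) => [|k]; last by rewrite !mxE uij.
suff -> : vdm u = 0 by rewrite mulr0.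
wlog lt_ij : i j ij uij / (i < j)%N.
  move=> W; move: (ij); rewrite -val_eqE neq_ltn => /orP[|lt]; first exact: W.
  by apply: (W j i) => //; rewrite eq_sym.
by rewrite /vdm (bigD1 i) //= (bigD1 j) //= uij subrr !mul0r.
Qed.

End Laurent.

(** * Splitting one index off a Vandermonde product *)

Lemma vdm_recl (A : comNzRingType) n (u : 'I_n.+1 -> A) :
  vdm u = \prod_(k < n) (u ord0 - u (lift ord0 k)) * vdm (fun k => u (lift ord0 k)).
Proof.
rewrite /vdm big_ord_recl; congr (_ * _).
  by rewrite big_mkcond big_ord_recl /= mul1r; apply: eq_bigr.
apply: eq_bigr => i _; rewrite big_mkcond big_ord_recl /= mul1r [RHS]big_mkcond.
by apply: eq_bigr.
Qed.

(** Of the factors that involve [u j], exactly [j] have [u j] as their second term; turning these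
    around produces the sign. *)
Lemma vdm_lift (A : comNzRingType) n (u : 'I_n.+1 -> A) (j : 'I_n.+1) :
  vdm u = (-1) ^+ j * \prod_(i < n.+1 | i != j) (u j - u i) *
          vdm (fun k => u (lift j k)).
Proof.
(* Padding with 1 makes both products unconditional, so that index [j] can be split off each of
   them. *)
pose F (i k : 'I_n.+1) := if (i < k)%N then u i - u k else 1.
have -> : vdm u = \prod_i \prod_k F i k.
  by apply: eq_bigr => i _; rewrite big_mkcond.
rewrite (bigD1_ord j) //= (bigD1_ord j) //= {1}/F ltnn mul1r.
under [X in _ * X]eq_bigr => i _ do rewrite (bigD1_ord j) //=.
rewrite big_split /= mulrA -big_split /=; congr (_ * _); last first.
  apply: eq_bigr => i _; rewrite [RHS]big_mkcond; apply: eq_bigr => k _.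
  by rewrite /F /= /bump; do 2 case: ifP => //; lia.
rewrite [in RHS]big_mkcond [in RHS](bigD1_ord j) //= eqxx mul1r.
have -> : (-1) ^+ j = \prod_(k < n | (k < j)%N) (-1) :> A.
  have jn : (j <= n)%N by rewrite -ltnS ltn_ord.
  by rewrite -(big_ord_widen _ (fun=> -1) jn) prodr_const card_ord.
rewrite [X in X * _]big_mkcond -big_split /=.
apply: eq_bigr => k _; rewrite /F [lift j k == j]eq_sym neq_lift /= /bump.
case: (leqP j k) => jk;
  first by rewrite add1n ltnS jk ltnNge leqW ?mul1r ?mulr1.
by rewrite add0n jk ltnNge ltnW //= mul1r mulN1r opprB.
Qed.

(** * Laurent polynomial functions of [q] and their value at 1 *)

Section LaurentFun.
Variable F : numFieldType.

(** The factor [q ^+ M] clears the negative powers; nothing is asked at 0. *)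
Definition laurent_fun (f : F -> F) := exists (P : {poly F}) (M : nat),
  forall q, q != 0 -> f q * q ^+ M = P.[q].

Lemma laurent_fun_cst c : laurent_fun (fun=> c).
Proof. by exists c%:P, 0%N => q _; rewrite hornerC mulr1. Qed.

Lemma laurent_funD f g : laurent_fun f -> laurent_fun g ->
  laurent_fun (fun q => f q + g q).
Proof.
move=> [P [M HP]] [Q [M' HQ]].
exists (P * 'X^M' + Q * 'X^M), (M + M')%N => q q0.
by rewrite !hornerE -HP // -HQ // exprD; ring.
Qed.

Lemma laurent_funM f g : laurent_fun f -> laurent_fun g ->
  laurent_fun (fun q => f q * g q).
Proof.
move=> [P [M HP]] [Q [M' HQ]].
exists (P * Q), (M + M')%N => q q0.
by rewrite !hornerE -HP // -HQ // exprD; ring.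
Qed.

Lemma laurent_fun_sum (I : Type) (r : seq I) (p : pred I) (f : I -> F -> F) :
  (forall i, laurent_fun (f i)) ->
  laurent_fun (fun q => \sum_(i <- r | p i) f i q).
Proof.
move=> Hf; elim: r => [|i r IH].
  by under [X in laurent_fun X]funext do rewrite big_nil;
    exact: laurent_fun_cst.
under [X in laurent_fun X]funext do rewrite big_cons.
by case: (p i) => //; apply: laurent_funD.
Qed.

Lemma laurent_fun_prod (I : Type) (r : seq I) (p : pred I) (f : I -> F -> F) :
  (forall i, laurent_fun (f i)) ->
  laurent_fun (fun q => \prod_(i <- r | p i) f i q).
Proof.
move=> Hf; elim: r => [|i r IH].
  by under [X in laurent_fun X]funext do rewrite big_nil;
    exact: laurent_fun_cst.
under [X in laurent_fun X]funext do rewrite big_cons.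
by case: (p i) => //; apply: laurent_funM.
Qed.

Lemma laurent_funXz (e : int) : laurent_fun (fun q => q ^ e).
Proof.
case: e => n; first by exists 'X^n, 0%N => q _; rewrite hornerXn mulr1.
exists 1, n.+1 => q q0; rewrite hornerC NegzE -exprnN mulVf //.
by rewrite expf_neq0.
Qed.

(** This replaces the limit [q -> 1]: after clearing denominators, the difference is a polynomial
    with infinitely many roots, hence zero, and it may be evaluated at 1. *)
Lemma laurent_fun_eq1 f g : laurent_fun f -> laurent_fun g ->
  (forall q, q != 0 -> q != 1 -> f q = g q) -> f 1 = g 1.
Proof.
move=> [P [M HP]] [Q [M' HQ]] fg.
have D0 : P * 'X^M' - Q * 'X^M = 0.
  apply/eqP/negbNE/negP => D0.
  (* The points 2, 3, 4, ... are distinct in characteristic zero and avoid 0 and 1; taking as many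
     as the size of the polynomial exceeds its possible number of roots. *)
  pose s : seq F := [seq i.+2%:R | i <- iota 0 (size (P * 'X^M' - Q * 'X^M)%R)].
  have : (size s < size (P * 'X^M' - Q * 'X^M)%R)%N.
    apply: max_poly_roots => //; last first.
      by rewrite map_inj_uniq ?iota_uniq // => i j /eqP;
        rewrite eqr_nat => /eqP[].
    apply/allP => q /mapP [i _ ->].
    have q0 : i.+2%:R != 0 :> F by rewrite pnatr_eq0.
    have q1 : i.+2%:R != 1 :> F by rewrite (eqr_nat F _ 1).
    by rewrite /root !hornerE -HP // -HQ // fg // subr_eq0 mulrAC.
  by rewrite size_map size_iota ltnn.
have := congr1 (horner^~ 1) D0.
rewrite !hornerE !expr1n !mulr1 -HP ?oner_neq0 // -HQ ?oner_neq0 //.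
by rewrite !expr1n !mulr1 => /eqP; rewrite subr_eq0 => /eqP.
Qed.

(* The Laurent polynomial (q^a - q^b) / (q - 1). *)
Definition qdiff (a b : int) (q : F) : F :=
  if b <= a then q ^ b * \sum_(i < absz (a - b)) q ^ i
  else - (q ^ a * \sum_(i < absz (b - a)) q ^ i).

Lemma laurent_fun_qdiff a b : laurent_fun (qdiff a b).
Proof.
rewrite /qdiff; case: (b <= a).
  apply: laurent_funM; first exact: laurent_funXz.
  by apply: laurent_fun_sum => i; exact: laurent_funXz.
under [X in laurent_fun X]funext do rewrite -mulN1r.
apply: laurent_funM; first exact: laurent_fun_cst.
apply: laurent_funM; first exact: laurent_funXz.
by apply: laurent_fun_sum => i; exact: laurent_funXz.
Qed.

Lemma qdiffE a b q : q != 0 -> q ^ a - q ^ b = (q - 1) * qdiff a b q.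
Proof.
move=> q0; have H c d : c <= d ->
    q ^ d - q ^ c = (q - 1) * (q ^ c * \sum_(i < absz (d - c)) q ^ i).
  move=> cd; rewrite mulrCA; under eq_bigr do rewrite -exprnP.
  rewrite -subrX1 mulrBr mulr1; congr (_ - _).
  by rewrite exprnP gez0_abs ?subr_ge0 // -expfzDr // [c + _]addrC subrK.
rewrite /qdiff; case: ifPn => [/H //|]; rewrite -ltNge => /ltW /H E.
by rewrite mulrN -E opprB.
Qed.

Lemma qdiff1 a b : qdiff a b 1 = (a - b)%:~R.
Proof.
rewrite /qdiff; case: ifPn => [ba|].
  under eq_bigr do rewrite exp1rz.
  by rewrite exp1rz mul1r sumr_const card_ord -{2}[a - b]gez0_abs ?subr_ge0.
rewrite -ltNge => /ltW ab; under eq_bigr do rewrite exp1rz.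
rewrite exp1rz mul1r sumr_const card_ord -(opprB b a) mulrNz; congr (- _).
by rewrite -{2}[b - a]gez0_abs ?subr_ge0.
Qed.

(** The Vandermonde product in the [q ^ b i] with one factor [q - 1] removed for each pair, so that
    it no longer degenerates at [q = 1] when the [b i] are distinct. *)
Definition qvdm n (b : 'I_n -> int) (q : F) : F :=
  \prod_(i < n) \prod_(j < n | (i < j)%N) qdiff (b i) (b j) q.

Lemma laurent_fun_qvdm n (b : 'I_n -> int) : laurent_fun (qvdm b).
Proof. by do 2 apply: laurent_fun_prod => ?; exact: laurent_fun_qdiff. Qed.

Lemma vdmXz n (b : 'I_n -> int) q : q != 0 ->
  vdm (fun i => q ^ b i) = 
   (\prod_(i < n) \prod_(j < n | (i < j)%N) (q - 1)) * qvdm b q.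
Proof.
move=> q0; rewrite /vdm /qvdm -big_split; apply: eq_bigr => i _ /=.
by rewrite -big_split; apply: eq_bigr => j _ /=; rewrite qdiffE.
Qed.

Lemma qvdm1 n (b : 'I_n -> int) : qvdm b 1 = vdm (fun i => (b i)%:~R).
Proof.
by do 2 (apply: eq_bigr => ? _); rewrite qdiff1 rmorphB.
Qed.

End LaurentFun.

Lemma det_exp_vdm (A : comNzRingType) n (v : 'I_n -> A) :
  \det (\matrix_(i < n, j < n) v j ^+ i) =
  (\prod_(i < n) \prod_(j < n | (i < j)%N) (-1)) * vdm v.
Proof.
have -> : \matrix_(i < n, j < n) v j ^+ i = Vandermonde n (\row_j v j).
  by apply/matrixP => i j; rewrite !mxE.
rewrite det_Vandermonde /vdm -big_split; apply: eq_bigr => i _ /=.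
by rewrite -big_split; apply: eq_bigr => j _ /=; rewrite !mxE mulN1r opprB.
Qed.

(** * Principal specialization and the explicit sum for the normalized Schur function *)

Section Specialization.
Variables (R : realType).
Local Notation K := R[i].

Lemma laurent_fun_eval n (p : laurent R n) (u : K -> 'I_n -> K) :
  (forall i m, laurent_fun (fun q => u q i ^ m)) ->
  laurent_fun (fun q => laurent_eval p (u q)).
Proof.
move=> Hu; apply: laurent_fun_sum => m; apply: laurent_funM.
  exact: laurent_fun_cst.
by apply: laurent_fun_prod => i.
Qed.

Lemma exprz_swap (q : K) (i : nat) (a : int) : (q ^+ i) ^ a = (q ^ a) ^+ i.
Proof. by rewrite !exprnP !exprz_exp mulrC. Qed.

(* Principal specialization u_i = q^i, then q -> 1. *)
Lemma rational_schur1 n (l : 'I_n -> int) :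
  laurent_eval (rational_schur R l) (fun=> 1) *
    vdm (fun i : 'I_n => (i : nat)%:R) =
  (\prod_(i < n) \prod_(j < n | (i < j)%N) (-1)) *
    vdm (fun i => (shifted l i)%:~R) :> K.
Proof.
pose f q : K := laurent_eval (rational_schur R l) (fun i : 'I_n => q ^+ i) *
  qvdm (fun i : 'I_n => (i : nat)%:Z) q.
pose g q : K := (\prod_(i < n) \prod_(j < n | (i < j)%N) (-1)) *
  qvdm (shifted l) q.
have := @laurent_fun_eq1 _ f g; rewrite /f /g !qvdm1.
under [X in laurent_eval _ X]funext do rewrite expr1n.
apply.
- apply: laurent_funM; last exact: laurent_fun_qvdm.
  apply: laurent_fun_eval => i m.
  under [X in laurent_fun X]funext do rewrite exprnP exprz_exp.
  exact: laurent_funXz.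
- by apply: laurent_funM; [exact: laurent_fun_cst|exact: laurent_fun_qvdm].
move=> q q0 q1.
have w0 : \prod_(i < n) \prod_(j < n | (i < j)%N) (q - 1) != 0.
  by do 2 apply/prodf_neq0 => ? _; rewrite subr_eq0.
apply: (mulfI w0); rewrite mulrCA -vdmXz // [RHS]mulrCA -vdmXz //.
rewrite -det_exp_vdm rational_schur_vdm => [|i]; last by rewrite expf_neq0.
by congr (\det _); apply/matrixP => i j; rewrite !mxE exprz_swap.
Qed.

(** Expanding the determinant along the row of [x] leaves minors that are Vandermonde determinants
    in the [q ^ shifted l k] with [k != j]. Both sides carry the same power of [q - 1], which is
    cancelled before setting [q = 1]. *)
Lemma rational_schur_x n (l : 'I_n.+1 -> int) (x : K) : x != 0 ->
  laurent_eval (rational_schur R l) (fun i => nth 1 [tuple x] i) *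
    ((x - 1) ^+ n * vdm (fun i : 'I_n => (i : nat)%:R)) =
  \sum_j x ^ shifted l j * ((-1) ^+ j *
    ((\prod_(i < n) \prod_(k < n | (i < k)%N) (-1)) *
    vdm (fun k => (shifted l (lift j k))%:~R))) :> K.
Proof.
move=> x0.
(* The point [(x, 1, q, .., q^(n-1))], which at [q = 1] becomes the argument of
   [normalized_schur]. *)
pose u q (i : 'I_n.+1) : K := if i == 0%N :> nat then x else q ^+ i.-1.
pose f q : K := laurent_eval (rational_schur R l) (u q) *
  (\prod_(k < n) (x - q ^+ k) * qvdm (fun i : 'I_n => (i : nat)%:Z) q).
pose g q : K := \sum_j x ^ shifted l j * ((-1) ^+ j *
    ((\prod_(i < n) \prod_(k < n | (i < k)%N) (-1)) *
    qvdm (shifted l \o lift j) q)).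
suff : f 1 = g 1.
  rewrite /f /g qvdm1.
  have -> : \prod_(k < n) (x - 1 ^+ k) = (x - 1) ^+ n.
    by under eq_bigr do rewrite expr1n; rewrite prodr_const card_ord.
  have -> : u 1 = fun i => nth 1 [tuple x] i.
    by apply/funext => -[[|i] ?]; rewrite /u /= ?expr1n ?nth_nil.
  by move=> ->; apply: eq_bigr => j _; rewrite qvdm1.
apply: laurent_fun_eq1; rewrite /f /g.
- apply: laurent_funM.
    apply: laurent_fun_eval => i m; rewrite /u; case: eqP => _.
      exact: laurent_fun_cst.
    under [X in laurent_fun X]funext do rewrite exprnP exprz_exp.
    exact: laurent_funXz.
  apply: laurent_funM; last exact: laurent_fun_qvdm.
  apply: laurent_fun_prod => k; apply: laurent_funD.
    exact: laurent_fun_cst.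
  under [X in laurent_fun X]funext do rewrite -mulN1r exprnP.
  by apply: laurent_funM; [exact: laurent_fun_cst|exact: laurent_funXz].
- apply: laurent_fun_sum => j; do 3 (apply: laurent_funM; first exact: laurent_fun_cst).
  exact: laurent_fun_qvdm.
move=> q q0 q1.
have w0 : \prod_(i < n) \prod_(j < n | (i < j)%N) (q - 1) != 0.
  by do 2 apply/prodf_neq0 => ? _; rewrite subr_eq0.
(* Multiplying by the nonzero factors [q - 1] turns each [qvdm] back into a true Vandermonde
   product. *)
apply: (mulfI w0); rewrite mulrCA [X in _ * X]mulrCA -vdmXz //.
have -> : \prod_(k < n) (x - q ^+ k) * vdm (fun i : 'I_n => q ^ (i : nat)) = vdm (u q).
  by rewrite vdm_recl.
rewrite rational_schur_vdm => [|i]; last first.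
  by rewrite /u; case: ifP => // _; rewrite expf_neq0.
rewrite (expand_det_row _ ord0) mulr_sumr; apply: eq_bigr => j _.
rewrite mxE [RHS]mulrCA; congr (_ * _).
rewrite /cofactor add0n [RHS]mulrCA; congr (_ * _).
rewrite [RHS]mulrCA -vdmXz // -det_exp_vdm; congr (\det _).
by apply/matrixP => i k; rewrite !mxE exprz_swap.
Qed.

(** Adding the strictly decreasing [N - j.+1] to a weakly decreasing sequence makes it strictly
    decreasing. *)
Lemma shifted_inj n (l : 'I_n -> int) : signature l -> injective (shifted l).
Proof.
move=> hl i j; wlog ij : i j / (i <= j)%N => [W|].
  by case/orP: (leq_total i j) => /W // W' /esym /W' ->.
move=> e; apply/val_inj/eqP; rewrite eqn_leq ij /=.
have := hl _ _ ij; move: e; rewrite /shifted.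
have := ltn_ord i; have := ltn_ord j; lia.
Qed.

Lemma sgn_recl n :
  \prod_(i < n.+1) \prod_(j < n.+1 | (i < j)%N) (-1) =
  (-1) ^+ n * \prod_(i < n) \prod_(j < n | (i < j)%N) (-1) :> K.
Proof.
rewrite big_ord_recl; congr (_ * _).
  by rewrite big_mkcond big_ord_recl /= mul1r prodr_const card_ord.
apply: eq_bigr => i _; rewrite big_mkcond big_ord_recl /= mul1r [RHS]big_mkcond.
by apply: eq_bigr.
Qed.

(** This is the quotient of the two specializations. By [vdm_lift], the Vandermonde product without
    index [j], divided by the full one, is up to sign the inverse of the product of the
    [a j - a i]. *)
Lemma normalized_schurE n (l : 'I_n.+1 -> int) (x : K) :
  signature l -> x != 0 -> x != 1 ->
  normalized_schur l [tuple x] = n`!%:R / (x - 1) ^+ n *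
    \sum_j x ^ shifted l j /
      \prod_(i < n.+1 | i != j) ((shifted l j)%:~R - (shifted l i)%:~R).
Proof.
move=> hl x0 x1.
pose a j : K := (shifted l j)%:~R.
have ai : injective a by move=> i j /intr_inj /(shifted_inj hl).
have y0 : (x - 1) ^+ n != 0 by rewrite expf_neq0 // subr_eq0.
have vi m : vdm (fun i : 'I_m => (i : nat)%:R) != 0 :> K.
  by apply: vdm_neq0 => i j /eqP; rewrite eqr_nat => /eqP /val_inj.
have sgn0 m : \prod_(i < m) \prod_(j < m | (i < j)%N) (-1) != 0 :> K.
  by do 2 apply/prodf_neq0 => ? _; rewrite oppr_eq0 oner_eq0.
set s1 := laurent_eval (rational_schur R l) (fun=> 1).
set V : K := vdm (fun i : 'I_n => (i : nat)%:R).
set sg : K := \prod_(i < n) \prod_(j < n | (i < j)%N) (-1).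
(* In the Vandermonde product of 0, ..., n, the factors of index 0 multiply to [(-1) ^+ n * n!],
   whose sign cancels the one from [sgn_recl]. *)
have S1 : s1 * n`!%:R * V = sg * vdm a.
  have := rational_schur1 l; rewrite -/s1 -/a.
  rewrite vdm_recl sgn_recl -/sg.
  have -> : \prod_(k < n) (0%:R - (bump 0 k)%:R) = (-1) ^+ n * n`!%:R :> K.
    rewrite fact_prod big_add1 /= big_mkord natr_prod.
    rewrite -[n in (-1) ^+ n]card_ord -prodr_const -big_split.
    by apply: eq_bigr => k _; rewrite /= sub0r mulN1r.
  have -> : vdm (fun k : 'I_n => (bump 0 k)%:R) = V.
    do 2 apply: eq_bigr => ? _.
    by rewrite /bump !natrD opprD addrACA subrr add0r.
  move=> H.
  apply: (mulfI (_ : (-1) ^+ n != 0)); first by rewrite signr_eq0.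
  by rewrite [RHS]mulrA -H; ring.
(* The right-hand side of [S1] is nonzero because the shifted exponents are distinct. *)
have s10 : s1 != 0.
  apply/eqP => s10; move: S1; rewrite s10 !mul0r => /esym/eqP.
  by rewrite mulf_eq0 (negPf (sgn0 n)) (negPf (vdm_neq0 ai)).
rewrite /normalized_schur -/s1; apply: (canLR (mulfK s10)).
apply: (mulIf (mulf_neq0 y0 (vi n))); rewrite rational_schur_x // -/V -/sg.
transitivity (s1 * n`!%:R * V *
   \sum_j x ^ shifted l j / \prod_(i < n.+1 | i != j) (a j - a i)); last by field.
rewrite S1 mulr_sumr; apply: eq_bigr => j _.
have P0 : \prod_(i < n.+1 | i != j) (a j - a i) != 0.
  by apply/prodf_neq0 => i ij; rewrite subr_eq0 (inj_eq ai) eq_sym.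
by rewrite (vdm_lift a j); field.
Qed.

End Specialization.

(** * Piecewise continuous functions *)

Section PiecewiseContinuity.
Variable R : realType.
Implicit Types (P Q : R -> R -> Prop) (k F : R -> R) (s : seq R).
Local Notation mu := (@lebesgue_measure R).

(** Recursion on the list of nodes lets each later induction peel off the first interval of a
    partition. *)
Fixpoint on_pieces P (a : R) s : Prop :=
  if s is b :: s' then P a b /\ on_pieces P b s' else True.

Lemma on_pieces_nth P a s :
  (forall i, (i < size s)%N -> P (nth 0 (a :: s) i) (nth 0 (a :: s) i.+1)) ->
  on_pieces P a s.
Proof.
elim: s a => //= b s IH a H; split; first exact: (H 0%N).
by apply: IH => i; exact: (H i.+1).
Qed.

Lemma itv_partition_le (a b : R) s : itv_partition a b s -> a <= b.
Proof.
elim: s a => [a /itv_partition_nil -> //|c s IH a H].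
by case: (H) => /= /andP[/ltW ac _] _; rewrite (le_trans ac) //;
  exact: IH (itv_partition_cons H).
Qed.

Lemma on_pieces_imp P Q (a b : R) s : itv_partition a b s ->
  (forall p q, a <= p -> p < q -> q <= b -> P p q -> Q p q) ->
  on_pieces P a s -> on_pieces Q a s.
Proof.
elim: s a => //= c s IH a H PQ [Pac Ps]; have H' := itv_partition_cons H.
case: (H) => /= /andP[ac _] _; split.
  by apply: PQ => //; exact: itv_partition_le H'.
by apply: IH Ps => // p q cp; apply: PQ; exact: le_trans (ltW ac) cp.
Qed.

Lemma on_pieces_true P (a b : R) s : itv_partition a b s ->
  (forall p q, a <= p -> p < q -> q <= b -> P p q) -> on_pieces P a s.
Proof.
move=> H HP; have T a' s' : on_pieces (fun _ _ => True) a' s' by elim: s' a' => //=.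
by apply: on_pieces_imp H _ (T a s) => p q ap pq qb _; exact: HP.
Qed.

Lemma on_pieces_and P Q (a : R) s : on_pieces P a s -> on_pieces Q a s ->
  on_pieces (fun p q => P p q /\ Q p q) a s.
Proof. by elim: s a => //= c s IH a [? ?] [? ?]; split => //; exact: IH. Qed.

(** The values of [k] at [p] and [q] are left free, since [velocity] need not be meaningful at the
    corners of a curve. *)
Definition extends_cont (p q : R) k : Prop :=
  exists2 k', {within `[p, q], continuous k'} & forall t, p < t < q -> k t = k' t.

Definition pw_cont a s k := on_pieces (fun p q => extends_cont p q k) a s.

Lemma extends_cont_continuous p q k :
  {within `[p, q], continuous k} -> extends_cont p q k.
Proof. by exists k. Qed.

Lemma extends_contD p q k1 k2 : extends_cont p q k1 -> extends_cont p q k2 ->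
  extends_cont p q (fun t => k1 t + k2 t).
Proof.
move=> [h1 c1 e1] [h2 c2 e2]; exists (fun t => h1 t + h2 t).
  by move=> x; apply: cvgD; [exact: c1|exact: c2].
by move=> t tpq; rewrite e1 // e2.
Qed.

Lemma extends_contM p q k1 k2 : extends_cont p q k1 -> extends_cont p q k2 ->
  extends_cont p q (fun t => k1 t * k2 t).
Proof.
move=> [h1 c1 e1] [h2 c2 e2]; exists (fun t => h1 t * h2 t).
  by move=> x; apply: cvgM; [exact: c1|exact: c2].
by move=> t tpq; rewrite e1 // e2.
Qed.

Lemma extends_contN p q k : extends_cont p q k ->
  extends_cont p q (fun t => - k t).
Proof.
move=> [h c e]; exists (fun t => - h t); last by move=> t tpq; rewrite e.
by move=> x; apply: cvgN; exact: c.
Qed.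

Lemma within_continuous_measurable (p q : R) k :
  {within `[p, q], continuous k} -> measurable_fun `[p, q] k.
Proof. by move=> ck; apply: measurable_realfun.subspace_continuous_measurable_fun. Qed.

Lemma extends_cont_measurable p q k : extends_cont p q k -> measurable_fun `[p, q] k.
Proof.
move=> [k' c e]; apply: (@measurable_realfun.measurable_fun_itv_cc _ _ _ false true).
apply: (eq_measurable_fun k').
  by move=> t; rewrite inE /= in_itv /= => /e ->.
apply: measurable_funS (within_continuous_measurable c) => //.
by move=> t /=; rewrite !in_itv /= => /andP[/ltW -> /ltW ->].
Qed.

Lemma within_continuous_bounded (p q : R) k : p <= q ->
  {within `[p, q], continuous k} -> exists M, forall t, p <= t <= q -> `|k t| <= M.
Proof.
move=> pq ck; have [c _ Hc] := EVT_max pq ck; have [d _ Hd] := EVT_min pq ck.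
exists (Num.max `|k c| `|k d|) => t tpq.
have tI : t \in `[p, q] by rewrite in_itv.
rewrite ler_norml; apply/andP; split.
  rewrite (le_trans _ (Hd _ tI)) // lerNl (le_trans (ler_norm _)) // normrN.
  by rewrite le_max lexx orbT.
by rewrite (le_trans (Hc _ tI)) // (le_trans (ler_norm _)) // le_max lexx.
Qed.

Lemma extends_cont_bounded p q k : p < q -> extends_cont p q k ->
  exists M, forall t, p <= t <= q -> `|k t| <= M.
Proof.
move=> pq [k' c e]; have [M HM] := within_continuous_bounded (ltW pq) c.
(* The bound of the extension says nothing about [k] at the two endpoints, so these values are
   added. *)
exists (M + `|k p| + `|k q|) => t /andP[pt tq].
have M0 : 0 <= M by rewrite (le_trans _ (HM p _)) // lexx ltW.
have kp := normr_ge0 (k p); have kq := normr_ge0 (k q).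
have [->|tp] := eqVneq t p; first by lra.
have [->|tq'] := eqVneq t q; first by lra.
have tI : p < t < q by rewrite !lt_neqAle pt tq tq' eq_sym tp.
rewrite e //; have := HM t; rewrite pt tq => /(_ isT) Mt; lra.
Qed.

Lemma pw_cont_measurable (a b : R) s k : itv_partition a b s -> pw_cont a s k ->
  measurable_fun `[a, b] k.
Proof.
elim: s a => [a /itv_partition_nil <- _|c s IH a H [ac Hs]].
  by rewrite set_itv1; exact: measurable_fun_set1.
have H' := itv_partition_cons H; case: (H) => /= /andP[/ltW ac' _] _.
have cb := itv_partition_le H'.
rewrite (@itv_bndbnd_setU _ _ _ (BRight c)) ?bnd_simp //.
apply/measurable_funU => //; split; first exact: extends_cont_measurable.
apply: measurable_funS (IH _ H' Hs) => //.
by move=> t /=; rewrite !in_itv /= => /andP[/ltW -> ->].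
Qed.

Lemma pw_cont_bounded (a b : R) s k : itv_partition a b s -> pw_cont a s k ->
  exists M, forall t, a <= t <= b -> `|k t| <= M.
Proof.
elim: s a => [a /itv_partition_nil <- _|c s IH a H [ac Hs]].
  by exists `|k a| => t; rewrite -eq_le => /eqP ->.
have H' := itv_partition_cons H; case: (H) => /= /andP[ac' _] _.
have [M HM] := extends_cont_bounded ac' ac.
have [M' HM'] := IH _ H' Hs.
exists (Num.max M M') => t /andP[at_ tb]; rewrite le_max.
have [tc|/ltW ct] := leP t c; first by rewrite HM // at_.
by rewrite HM' ?orbT // ct.
Qed.

Lemma bounded_measurable_integrable (a b M : R) k : measurable_fun `[a, b] k ->
  (forall t, a <= t <= b -> `|k t| <= M) -> mu.-integrable `[a, b] (EFin \o k).
Proof.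
move=> mk HM; apply: measurable_bounded_integrable => //.
  by rewrite /= lebesgue_measure_itv /=; case: ifP; rewrite ?ltry.
exists M; split; first exact: num_real.
move=> x Mx t /=; rewrite in_itv /= => tab.
exact: le_trans (HM _ tab) (ltW Mx).
Qed.

Lemma pw_cont_integrable (a b : R) s k : itv_partition a b s -> pw_cont a s k ->
  mu.-integrable `[a, b] (EFin \o k).
Proof.
move=> H Hk; have [M HM] := pw_cont_bounded H Hk.
exact: bounded_measurable_integrable (pw_cont_measurable H Hk) HM.
Qed.

(** The fundamental theorem applies on each piece, and continuity of [F] across the nodes makes the
    increments telescope. *)
Lemma pw_cont_FTC (a b : R) s k F : itv_partition a b s -> pw_cont a s k ->
  {within `[a, b], continuous F} ->
  on_pieces (fun p q => forall t, p < t < q -> is_derive t 1 F (k t)) a s ->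
  \int[mu]_(t in `[a, b]) k t = F b - F a.
Proof.
elim: s a => [a /itv_partition_nil <- _ _ _|c s IH a H Hk cF [Fac Fs]].
  by rewrite set_itv1 Rintegral_set1 subrr.
have H' := itv_partition_cons H; case: (H) => /= /andP[ac _] _.
have cb := itv_partition_le H'.
have ik := pw_cont_integrable H Hk; case: (Hk) => kac ks.
rewrite -(subrK (\int[mu]_(t in `[a, c]) k t) (\int[mu]_(t in `[a, b]) k t)).
rewrite Rintegral_itvB ?bnd_simp ?(ltW ac) //.
have i2 : mu.-integrable `]c, b] (EFin \o k).
  apply: integrableS ik => //.
  by move=> t /=; rewrite !in_itv /= => /andP[/(lt_trans ac)/ltW -> ->].
rewrite Rintegral_itv_obnd_cbnd // IH //; last first.
  apply: continuous_subspaceW cF => t /=; rewrite !in_itv /= => /andP[ct ->].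
  by rewrite (le_trans (ltW ac)).
suff -> : \int[mu]_(t in `[a, c]) k t = F c - F a by rewrite addrA subrK.
have [k' ck' e] := kac.
have cFac : {within `[a, c], continuous F}.
  apply: continuous_subspaceW cF => t /=; rewrite !in_itv /= => /andP[-> tc].
  by rewrite (le_trans tc).
have [cF1 cF2 cF3] := (continuous_within_itvP F ac).1 cFac.
have oc : `]a, c[ `<=` `[a, c].
  by move=> t /=; rewrite !in_itv /= => /andP[/ltW -> /ltW ->].
(* Endpoints do not affect the integral, so [k] is replaced by its continuous extension [k']. *)
rewrite /Rintegral (@eq_integral_itv_bounded _ _ _ k' k true false).
- rewrite (@continuous_FTC2 _ k' F) // => [|t tac].
    split => // t tac; have := Fac t; rewrite in_itv /= in tac.
    by move=> /(_ tac) [].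
  have tac' : a < t < c by move: tac; rewrite in_itv.
  by rewrite derive1E -e //; have [] := Fac t tac'.
- by apply: measurable_funS (extends_cont_measurable kac).
- by apply: measurable_funS (within_continuous_measurable ck').
- by move=> t; rewrite in_itv /= => /e.
Qed.

End PiecewiseContinuity.

(** * Contour integrals *)

Section ComplexCurves.
Variable R : realType.
Implicit Types (h : R -> R[i]) (z w d c : R[i]) (t p q : R).
Local Notation Re := (@complex.Re R).
Local Notation Im := (@complex.Im R).

Lemma cReD z w : Re (z + w) = Re z + Re w. Proof. by case: z w => [? ?] []. Qed.
Lemma cImD z w : Im (z + w) = Im z + Im w. Proof. by case: z w => [? ?] []. Qed.
Lemma cReN z : Re (- z) = - Re z. Proof. by case: z. Qed.
Lemma cImN z : Im (- z) = - Im z. Proof. by case: z. Qed.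
Lemma cReM z w : Re (z * w) = Re z * Re w - Im z * Im w.
Proof. by case: z w => [? ?] []. Qed.
Lemma cImM z w : Im (z * w) = Re z * Im w + Im z * Re w.
Proof. by case: z w => [? ?] []. Qed.
Lemma cReV z : Re z^-1 = Re z / (Re z ^+ 2 + Im z ^+ 2).
Proof. by case: z. Qed.
Lemma cImV z : Im z^-1 = - (Im z / (Re z ^+ 2 + Im z ^+ 2)).
Proof. by case: z. Qed.

Definition ReImE := (cReD, cImD, cReN, cImN, cReM, cImM).

Lemma complex_ext z w : Re z = Re w -> Im z = Im w -> z = w.
Proof. by case: z w => [? ?] [? ?] /= -> ->. Qed.

Lemma norm2_gt0 z : z != 0 -> 0 < Re z ^+ 2 + Im z ^+ 2.
Proof.
case: z => a b; rewrite eq_complex /= negb_and => ab.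
rewrite lt_neqAle eq_sym paddr_eq0 ?sqr_ge0 // negb_and !sqrf_eq0 ab /=.
by rewrite addr_ge0 ?sqr_ge0.
Qed.

Lemma cexpD z w : cexp (z + w) = cexp z * cexp w.
Proof.
rewrite /cexp cReD cImD expRD; apply: complex_ext;
  rewrite !(ReImE, cosD, sinD) /=; ring.
Qed.

Lemma cexp0 : cexp (0 : R[i]) = 1.
Proof. by rewrite /cexp /= expR0 cos0 sin0; apply: complex_ext;
  rewrite ?ReImE /=; ring. Qed.

Lemma cexp_neq0 z : cexp z != 0.
Proof.
apply/eqP => e; have : cexp z * cexp (- z) = 1 by rewrite -cexpD subrr cexp0.
by rewrite e mul0r => /esym/eqP; rewrite oner_eq0.
Qed.

(** At integer exponents the choice of logarithm disappears: [cexp (a%:~R * lnx)] is the ordinary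
    power [x ^ a]. *)
Lemma cexp_intmul z (a : int) : cexp (a%:~R * z) = cexp z ^ a.
Proof.
have H n : cexp (n%:R * z) = cexp z ^+ n.
  by elim: n => [|n IH];
    rewrite ?mul0r ?cexp0 ?expr0 // -natr1 mulrDl mul1r cexpD IH exprSr.
case: a => n; first exact: H.
rewrite NegzE mulrNz mulNr -exprnN; apply: (mulIf (cexp_neq0 (n.+1%:R * z))).
by rewrite -cexpD addNr cexp0 H mulVf // expf_neq0 // cexp_neq0.
Qed.

(** Derivatives are taken in the real parameter, component by component, so that primitives along a
    curve need only real calculus. *)
Definition cderiv h t d : Prop :=
  is_derive t 1 (Re \o h) (Re d) /\ is_derive t 1 (Im \o h) (Im d).

Lemma cderivM h1 h2 t d1 d2 : cderiv h1 t d1 -> cderiv h2 t d2 ->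
  cderiv (fun t => h1 t * h2 t) t (h1 t * d2 + h2 t * d1).
Proof.
move=> [r1 i1] [r2 i2]; split.
  rewrite (_ : _ \o _ = (Re \o h1) * (Re \o h2) - (Im \o h1) * (Im \o h2));
    last first.
    by apply/funext => x; rewrite /= ReImE.
  by apply: is_derive_eq; rewrite /= !ReImE /GRing.scale /=; ring.
rewrite (_ : _ \o _ = (Re \o h1) * (Im \o h2) + (Im \o h1) * (Re \o h2));
  last first.
  by apply/funext => x; rewrite /= ReImE.
by apply: is_derive_eq; rewrite /= !ReImE /GRing.scale /=; ring.
Qed.

Lemma cderiv_cst c t : cderiv (fun=> c) t 0.
Proof. by split; apply: is_derive_cst. Qed.

Lemma cderivZ c h t d : cderiv h t d -> cderiv (fun t => c * h t) t (c * d).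
Proof.
by move=> /(cderivM (cderiv_cst c t)); rewrite mulr0 addr0.
Qed.

Lemma cderivB_cst h t d c : cderiv h t d -> cderiv (fun t => h t - c) t d.
Proof.
move=> [r i]; split.
  rewrite (_ : _ \o _ = (Re \o h) - cst (Re c)); last first.
    by apply/funext => x; rewrite /= !ReImE.
  by apply: is_derive_eq; rewrite subr0.
rewrite (_ : _ \o _ = (Im \o h) - cst (Im c)); last first.
  by apply/funext => x; rewrite /= !ReImE.
by apply: is_derive_eq; rewrite subr0.
Qed.

Lemma cderiv_cexp h t d : cderiv h t d ->
  cderiv (fun t => cexp (h t)) t (cexp (h t) * d).
Proof.
move=> [r i].
have e := is_derive1_comp (is_derive_expR (Re (h t))) r.
have c := is_derive1_comp (is_derive_cos (Im (h t))) i.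
have s := is_derive1_comp (is_derive_sin (Im (h t))) i.
split.
  rewrite (_ : _ \o _ = (expR \o (Re \o h)) * (cos \o (Im \o h))); last first.
    by apply/funext => x; rewrite /cexp /= mul0r subr0.
  by apply: is_derive_eq; rewrite /cexp /= ?ReImE /GRing.scale /=; ring.
rewrite (_ : _ \o _ = (expR \o (Re \o h)) * (sin \o (Im \o h))); last first.
  by apply/funext => x; rewrite /cexp /= mul0r addr0.
by apply: is_derive_eq; rewrite /cexp /= ?ReImE /GRing.scale /=; ring.
Qed.

Definition ccont p q h : Prop :=
  {within `[p, q], continuous (Re \o h)} /\ {within `[p, q], continuous (Im \o h)}.

Lemma ccont_sub p q p' q' h : p <= p' -> q' <= q -> ccont p q h -> ccont p' q' h.
Proof.
move=> pp' qq' [r i]; have sub : `[p', q'] `<=` `[p, q].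
  move=> t /=; rewrite !in_itv /= => /andP[t1 t2].
  by rewrite (le_trans pp') // (le_trans t2).
by split; [exact: continuous_subspaceW r|exact: continuous_subspaceW i].
Qed.

Lemma ccont_cst p q c : ccont p q (fun=> c).
Proof. by split; move=> x; exact: cvg_cst. Qed.

Lemma ccontM p q h1 h2 : ccont p q h1 -> ccont p q h2 ->
  ccont p q (fun t => h1 t * h2 t).
Proof.
move=> [r1 i1] [r2 i2]; split.
  rewrite (_ : _ \o _ = fun t => Re (h1 t) * Re (h2 t) - Im (h1 t) * Im (h2 t)); last first.
    by apply/funext => x; rewrite /= ReImE.
  by move=> x; apply: cvgB; apply: cvgM;
    [exact: r1|exact: r2|exact: i1|exact: i2].
rewrite (_ : _ \o _ = fun t => Re (h1 t) * Im (h2 t) + Im (h1 t) * Re (h2 t));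
  last first.
  by apply/funext => x; rewrite /= ReImE.
by move=> x; apply: cvgD; apply: cvgM;
  [exact: r1|exact: i2|exact: i1|exact: r2].
Qed.

Lemma ccontB_cst p q h c : ccont p q h -> ccont p q (fun t => h t - c).
Proof.
move=> [r i]; split.
  rewrite (_ : _ \o _ = fun t => Re (h t) - Re c); last first.
    by apply/funext => x; rewrite /= !ReImE.
  by move=> x; apply: cvgB; [exact: r|exact: cvg_cst].
rewrite (_ : _ \o _ = fun t => Im (h t) - Im c); last first.
  by apply/funext => x; rewrite /= !ReImE.
by move=> x; apply: cvgB; [exact: i|exact: cvg_cst].
Qed.

Lemma within_continuous_comp (f g : R -> R) p q :
  {within `[p, q], continuous g} -> continuous f ->
  {within `[p, q], continuous (f \o g)}.
Proof.
move=> cg cf x; apply: (@continuous_comp (subspace `[p, q]) R R g f);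
  last exact: cf.
exact: cg.
Qed.

Lemma ccont_cexp p q h : ccont p q h -> ccont p q (fun t => cexp (h t)).
Proof.
move=> [r i].
have e := within_continuous_comp r (@continuous_expR R).
have c := within_continuous_comp i (@continuous_cos R).
have s := within_continuous_comp i (@continuous_sin R).
split.
  rewrite (_ : _ \o _ = fun t => expR (Re (h t)) * cos (Im (h t))); last first.
    by apply/funext => x; rewrite /cexp /= mul0r subr0.
  by move=> x; apply: cvgM; [exact: e|exact: c].
rewrite (_ : _ \o _ = fun t => expR (Re (h t)) * sin (Im (h t))); last first.
  by apply/funext => x; rewrite /cexp /= mul0r addr0.
by move=> x; apply: cvgM; [exact: e|exact: s].
Qed.

End ComplexCurves.

(** * Integrals of piecewise continuous complex functions *)

Section ComplexIntegrals.
Variable R : realType.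
Implicit Types (h k F : R -> R[i]) (z w d c : R[i]) (t p q : R) (s : seq R).
Local Notation mu := (@lebesgue_measure R).
Local Notation Re := (@complex.Re R).
Local Notation Im := (@complex.Im R).

Lemma continuous_Re : continuous (Re : R[i]^o -> R).
Proof.
move=> z; have FF : Filter (nbhs (z : R[i]^o)) by exact: nbhs_filter.
apply/cvgrPdist_lt => e e0.
have e0' : 0 < e%:C by rewrite ltcR.
exists e%:C => // w /=; rewrite -ltcR; apply: le_lt_trans.
by rewrite -cReN -cReD normc_ge_Re.
Qed.

Lemma continuous_Im : continuous (Im : R[i]^o -> R).
Proof.
move=> z; have FF : Filter (nbhs (z : R[i]^o)) by exact: nbhs_filter.
apply/cvgrPdist_lt => e e0.
have e0' : 0 < e%:C by rewrite ltcR.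
exists e%:C => // w /=; rewrite -ltcR; apply: le_lt_trans.
(* Up to sign, the imaginary part is the real part of the product with ['i], so the bound by the
   modulus carries over. *)
rewrite -cImN -cImD -[X in Im X]opprK cImN -ReiNIm.
apply: le_trans (normc_ge_Re _) _.
by rewrite normrM normrN [X in _ * X]normc_def /= expr0n expr1n add0r sqrtr1 mulr1.
Qed.

Lemma ccont_curve (g : R -> R[i]) :
  {within `[0, 1], continuous (g : R -> R[i]^o)} -> ccont 0 1 g.
Proof.
move=> cg; split=> x.
  apply: (@continuous_comp (subspace (`[0, 1] : set R)) R[i]^o R g Re).
    exact: cg.
  exact: continuous_Re.
apply: (@continuous_comp (subspace (`[0, 1] : set R)) R[i]^o R g Im).
  exact: cg.
exact: continuous_Im.
Qed.

Lemma ccontV p q h : (forall t, p <= t <= q -> h t != 0) -> ccont p q h ->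
  ccont p q (fun t => (h t)^-1).
Proof.
move=> h0 [r i].
have n : {within `[p, q], continuous (fun t => (Re (h t) ^+ 2 + Im (h t) ^+ 2)^-1)}.
  apply/subspace_continuousP => x xI.
  apply: cvgV; first by rewrite gt_eqF // norm2_gt0 // h0 //; move: xI;
    rewrite /= in_itv.
  have rx := (subspace_continuousP _ _).1 r x xI.
  have ix := (subspace_continuousP _ _).1 i x xI.
  by apply: cvgD; rewrite expr2; apply: cvgM.
split.
  rewrite (_ : _ \o _ = fun t => Re (h t) * (Re (h t) ^+ 2 + Im (h t) ^+ 2)^-1); last first.
    by apply/funext => x; rewrite /= cReV.
  by move=> x; apply: cvgM; [exact: r|exact: n].
rewrite (_ : _ \o _ = fun t => - (Im (h t) * (Re (h t) ^+ 2 + Im (h t) ^+ 2)^-1)); last first.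
  by apply/funext => x; rewrite /= cImV.
by move=> x; apply: cvgN; apply: cvgM; [exact: i|exact: n].
Qed.

Definition cextends p q h : Prop :=
  extends_cont p q (Re \o h) /\ extends_cont p q (Im \o h).

Lemma ccont_extends p q h : ccont p q h -> cextends p q h.
Proof. by move=> [? ?]; split; exact: extends_cont_continuous. Qed.

Lemma cextendsM p q h k : cextends p q h -> cextends p q k ->
  cextends p q (fun t => h t * k t).
Proof.
move=> [r1 i1] [r2 i2]; split.
  rewrite (_ : _ \o _ = fun t => Re (h t) * Re (k t) + - (Im (h t) * Im (k t))); last first.
    by apply/funext => x; rewrite /= ReImE.
  by apply: extends_contD;
    [exact: extends_contM|apply/extends_contN/extends_contM].
rewrite (_ : _ \o _ = fun t => Re (h t) * Im (k t) + Im (h t) * Re (k t));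
  last first.
  by apply/funext => x; rewrite /= ReImE.
by apply: extends_contD; exact: extends_contM.
Qed.

Lemma cextendsD p q h k : cextends p q h -> cextends p q k ->
  cextends p q (fun t => h t + k t).
Proof.
move=> [r1 i1] [r2 i2]; split.
  rewrite (_ : _ \o _ = fun t => Re (h t) + Re (k t)); last first.
    by apply/funext => x; rewrite /= ReImE.
  exact: extends_contD.
rewrite (_ : _ \o _ = fun t => Im (h t) + Im (k t)); last first.
  by apply/funext => x; rewrite /= ReImE.
exact: extends_contD.
Qed.

Definition pw_ccont s h := on_pieces (fun p q => cextends p q h) 0 s.

Section Partition.
Variable s : seq R.
Hypothesis hs : itv_partition 0 1 s.

Lemma pw_ccont_Re h : pw_ccont s h -> pw_cont 0 s (Re \o h).
Proof. by apply: (on_pieces_imp hs) => p q _ _ _ []. Qed.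

Lemma pw_ccont_Im h : pw_ccont s h -> pw_cont 0 s (Im \o h).
Proof. by apply: (on_pieces_imp hs) => p q _ _ _ []. Qed.

Lemma ccont_pw_ccont h : ccont 0 1 h -> pw_ccont s h.
Proof.
move=> ch; apply: (on_pieces_true hs) => p q p0 pq q1.
by apply: ccont_extends; exact: ccont_sub ch.
Qed.

Lemma pw_ccontM h k : pw_ccont s h -> pw_ccont s k -> pw_ccont s (fun t => h t * k t).
Proof.
move=> Hh Hk; apply: (on_pieces_imp hs) (on_pieces_and Hh Hk) => p q _ _ _ [].
exact: cextendsM.
Qed.

Lemma pw_ccontD h k : pw_ccont s h -> pw_ccont s k -> pw_ccont s (fun t => h t + k t).
Proof.
move=> Hh Hk; apply: (on_pieces_imp hs) (on_pieces_and Hh Hk) => p q _ _ _ [].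
exact: cextendsD.
Qed.

Lemma integral01D h k : pw_ccont s h -> pw_ccont s k ->
  integral01 (fun t => h t + k t) = integral01 h + integral01 k.
Proof.
move=> Hh Hk.
have [rh ih] := (pw_cont_integrable hs (pw_ccont_Re Hh), pw_cont_integrable hs (pw_ccont_Im Hh)).
have [rk ik] := (pw_cont_integrable hs (pw_ccont_Re Hk), pw_cont_integrable hs (pw_ccont_Im Hk)).
apply: complex_ext; rewrite ReImE /= -RintegralD //.
  by apply: eq_Rintegral => t _ /=; rewrite ReImE.
by apply: eq_Rintegral => t _ /=; rewrite ReImE.
Qed.

Lemma integral01Z c h : pw_ccont s h ->
  integral01 (fun t => c * h t) = c * integral01 h.
Proof.
move=> Hh.
have [rh ih] := (pw_cont_integrable hs (pw_ccont_Re Hh), pw_cont_integrable hs (pw_ccont_Im Hh)).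
have iZ (a : R) (f : R -> R) : mu.-integrable `[0, 1] (EFin \o f) ->
    mu.-integrable `[0, 1] (EFin \o (fun t => a * f t)).
  by move=> fi; exact: (integrableZl _ a fi).
apply: complex_ext; rewrite ReImE /= -!RintegralZl //.
  rewrite -RintegralB //; [|exact: iZ|exact: iZ].
  by apply: eq_Rintegral => t _ /=; rewrite ReImE.
rewrite -RintegralD //; [|exact: iZ|exact: iZ].
by apply: eq_Rintegral => t _ /=; rewrite ReImE.
Qed.

Lemma pw_ccont_cst c : pw_ccont s (fun=> c).
Proof. by apply: ccont_pw_ccont; exact: ccont_cst. Qed.

(** Piecewise continuity of the partial sums is proved in the same induction because additivity of
    the integral requires it. *)
Lemma integral01_sum (I : Type) (r : seq I) (c : I -> R[i]) (h : I -> R -> R[i]) :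
  (forall i, pw_ccont s (h i)) ->
  pw_ccont s (fun t => \sum_(i <- r) c i * h i t) /\
  integral01 (fun t => \sum_(i <- r) c i * h i t) =
  \sum_(i <- r) c i * integral01 (h i).
Proof.
move=> Hh; elim: r => [|i r [IH1 IH2]].
  under [X in pw_ccont s X]funext do rewrite big_nil.
  under [X in integral01 X]funext do rewrite big_nil.
  split; first exact: pw_ccont_cst.
  rewrite big_nil /integral01; apply: complex_ext => /=.
    by rewrite Rintegral_cst //= mul0r.
  by rewrite Rintegral_cst //= mul0r.
under [X in pw_ccont s X]funext do rewrite big_cons.
under [X in integral01 X]funext do rewrite big_cons.
have Hi : pw_ccont s (fun t => c i * h i t) by apply: pw_ccontM => //;
  exact: pw_ccont_cst.
by split; [exact: pw_ccontD|rewrite integral01D // integral01Z // IH2 big_cons].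
Qed.

Lemma integral01_FTC F k : ccont 0 1 F -> pw_ccont s k ->
  on_pieces (fun p q => forall t, p < t < q -> cderiv F t (k t)) 0 s ->
  integral01 k = F 1 - F 0.
Proof.
move=> [rF iF] Hk HF; apply: complex_ext; rewrite ReImE ?cReN ?cImN /=.
  apply: (pw_cont_FTC hs (pw_ccont_Re Hk) rF).
  by apply: (on_pieces_imp hs) HF => p q _ _ _ H t /H [].
apply: (pw_cont_FTC hs (pw_ccont_Im Hk) iF).
by apply: (on_pieces_imp hs) HF => p q _ _ _ H t /H [].
Qed.

End Partition.

Lemma piecewise_C1_pw (g : R -> R[i]) : piecewise_C1 g ->
  exists s, [/\ itv_partition 0 1 s, ccont 0 1 g, pw_ccont s (velocity g) &
    on_pieces (fun p q => forall t, p < t < q -> cderiv g t (velocity g t)) 0 s].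
Proof.
move=> [cg [s hs H']]; exists s.
have H := @on_pieces_nth _ (fun p q => C1_on p q (Re \o g) /\ C1_on p q (Im \o g)) 0 s H'.
split => //.
- exact: ccont_curve.
- apply: (on_pieces_imp hs) H => p q _ pq _ [[r' cr r] [i' ci i]].
  split; [exists r'|exists i'] => // t tpq /=; rewrite derive1E.
    by have [_ ->] := r t tpq.
  by have [_ ->] := i t tpq.
- apply: (on_pieces_imp hs) H => p q _ pq _ [[r' cr r] [i' ci i]] t tpq.
  have [rt it] := (r t tpq, i t tpq).
  by split => /=; rewrite derive1E derive_val.
Qed.

End ComplexIntegrals.

(** * The integral of [1 / (z - a)] and the winding number *)

Section Winding.
Variable R : realType.
Local Notation Re := (@complex.Re R).
Local Notation Im := (@complex.Im R).

(* Near t the increment of theta is the arctangent of the tangent of the angle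
   between w t and the nearby values of w. *)
Lemma is_derive_argument (w : R -> R[i]) (r theta : R -> R) (t : R) (d : R[i]) :
  cderiv w t d -> {for t, continuous theta} ->
  (\forall x \near t, 0 < r x /\ w x = (r x)%:C * (cos (theta x) +i* sin (theta x))) ->
  is_derive t 1 theta (Im ((w t)^-1 * d)).
Proof.
move=> [dr di] ct wE.
have [rt wt] := nbhs_singleton wE.
have Rw : Re (w t) = r t * cos (theta t) by rewrite wt /=; ring.
have Iw : Im (w t) = r t * sin (theta t) by rewrite wt /=; ring.
have n2 : Re (w t) ^+ 2 + Im (w t) ^+ 2 = r t ^+ 2.
  by rewrite Rw Iw !exprMn -mulrDr cos2Dsin2 mulr1.
have n20 : r t ^+ 2 != 0 by rewrite expf_neq0 // gt_eqF.
(* [N] and [D] are the imaginary and real parts of [w x] times the conjugate of [w t], so [N / D] is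
   the tangent of [theta x - theta t]. *)
pose N := (Im \o w) * cst (Re (w t)) - (Re \o w) * cst (Im (w t)).
pose D := (Re \o w) * cst (Re (w t)) + (Im \o w) * cst (Im (w t)).
have DE x : D x = Re (w x) * Re (w t) + Im (w x) * Im (w t) by [].
have NE x : N x = Im (w x) * Re (w t) - Re (w x) * Im (w t) by [].
have Dt : D t = r t ^+ 2 by rewrite DE -n2 !expr2.
have Nt : N t = 0 by rewrite NE; ring.
pose q := N * (fun x => (D x)^-1).
have qE x : q x = N x / D x by [].
have dN : is_derive t 1 N (Im d * Re (w t) - Re d * Im (w t)).
  by apply: is_derive_eq; rewrite /cst /GRing.scale /=; ring.
have dD : is_derive t 1 D (Re d * Re (w t) + Im d * Im (w t)).
  by apply: is_derive_eq; rewrite /cst /GRing.scale /=; ring.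
have D0 : D t != 0 by rewrite Dt.
have dV := is_deriveV D0 dD.
have dq : is_derive t 1 q ((Im d * Re (w t) - Re d * Im (w t)) / r t ^+ 2).
  apply: (is_derive_eq (is_deriveM dN dV)).
  by rewrite Nt Dt /GRing.scale /= mul0r add0r mulrC.
have qt : q t = 0 by rewrite qE Nt mul0r.
have da := is_derive1_comp (is_derive1_atan (q t)) dq.
have dF : is_derive t 1 (cst (theta t) + (atan \o q)) (Im ((w t)^-1 * d)).
  apply: is_derive_eq.
  rewrite qt !ReImE cReV cImV n2 expr0n addr0 invr1 mul1r add0r; field.
  by move: n20; rewrite expf_eq0.
apply: near_eq_is_derive dF.
(* Continuity of [theta] keeps the increment inside the interval where the arctangent inverts the
   tangent. *)
have cond : \forall x \near t, `|theta t - theta x| < pi / 2.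
  by move/cvgrPdist_lt : ct; apply; rewrite divr_gt0 // pi_gt0.
apply: filterS2 wE cond => x [rx wx] tx.
have qx : q x = tan (theta x - theta t).
  have Rx : Re (w x) = r x * cos (theta x) by rewrite wx /=; ring.
  have Ix : Im (w x) = r x * sin (theta x) by rewrite wx /=; ring.
  have rr : r x * r t != 0 by rewrite mulf_neq0 // gt_eqF.
  rewrite qE DE NE Rw Iw Rx Ix /tan sinB cosB -[RHS]mul1r -(divff rr) mulf_div.
  by congr (_ / _); ring.
rewrite -[LHS]/(theta t + atan (q x)) qx tanK; first by rewrite addrC subrK.
by rewrite in_itv /=; move: tx; rewrite distrC ltr_norml.
Qed.

Lemma within_continuous_pt (f : R -> R) (a b t : R) : a < t < b ->
  {within `[a, b], continuous f} -> {for t, continuous f}.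
Proof.
move=> tab; have ab : a < b by case/andP: tab => /lt_trans; apply.
by move=> /(continuous_within_itvP f ab) [H _ _]; apply: H; rewrite in_itv.
Qed.

Lemma near_itv (a b t : R) : a < t < b -> \forall x \near t, a <= x <= b.
Proof.
move=> tab; have : \forall x \near t, x \in `]a, b[.
  by apply: near_in_itvoo; rewrite in_itv.
by apply: filterS => x; rewrite in_itv /= => /andP[/ltW -> /ltW ->].
Qed.

Lemma winding_integral (g : R -> R[i]) (a : R[i]) (s : seq R) :
  itv_partition 0 1 s -> ccont 0 1 g -> pw_ccont s (velocity g) ->
  on_pieces (fun p q => forall t, p < t < q -> cderiv g t (velocity g t)) 0 s ->
  g 0 = g 1 -> winds_once_counterclockwise g a ->
  (forall t, 0 <= t <= 1 -> g t - a != 0) /\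
  integral01 (fun t => (g t - a)^-1 * velocity g t) = 0 +i* (2 * pi).
Proof.
move=> hs cg vg dg g01 [r [theta [_ ctheta polar theta01]]].
pose w t := g t - a.
have wE t : 0 <= t <= 1 ->
    0 < r t /\ w t = (r t)%:C * (cos (theta t) +i* sin (theta t)).
  by move=> /polar [r0 gt]; rewrite /w gt addrC addKr.
have n2E t : 0 <= t <= 1 -> Re (w t) ^+ 2 + Im (w t) ^+ 2 = r t ^+ 2.
  move=> /wE [_ ->]; rewrite /= !mul0r subr0 addr0 !exprMn -mulrDr.
  by rewrite cos2Dsin2 mulr1.
have w0 t : 0 <= t <= 1 -> w t != 0.
  move=> t01; apply/eqP => wt; have [r0 _] := wE t t01; have := n2E t t01.
  by rewrite wt /= expr0n /= addr0 => /esym/eqP; rewrite expf_eq0 /= gt_eqF.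
split=> //.
have cw : ccont 0 1 w by exact: ccontB_cst.
pose n2 t := Re (w t) ^+ 2 + Im (w t) ^+ 2.
have n20 t : 0 <= t <= 1 -> 0 < n2 t by move=> /w0 /norm2_gt0.
(* The real part is the logarithm of the modulus, written with the squared modulus [n2]: this is
   differentiable with [w], whereas [r] is only known to be continuous. *)
pose F t := (ln (n2 t) / 2) +i* theta t.
have cF : ccont 0 1 F.
  case: cw => cr ci; split => //; apply/subspace_continuousP => x xI.
  have rx := (subspace_continuousP _ _).1 cr x xI.
  have ix := (subspace_continuousP _ _).1 ci x xI.
  apply: cvgM; last exact: cvg_cst.
  apply: (@continuous_cvg _ _ _ _ _ n2 (@ln R) (n2 x)).
    by apply: continuous_ln; apply: n20; move: xI; rewrite /= in_itv.
  by apply: cvgD; rewrite expr2; apply: cvgM.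
have Hk : pw_ccont s (fun t => (w t)^-1 * velocity g t).
  by apply: pw_ccontM => //; apply: ccont_pw_ccont => //; exact: ccontV.
rewrite (integral01_FTC hs cF Hk).
  (* The curve is closed, so the logarithm contributes nothing and only the increment of [theta]
     remains. *)
  by apply: complex_ext; rewrite /= /n2 /w ?g01 ?theta01; ring.
apply: (on_pieces_imp hs) dg => p q p0 pq q1 dg t tpq.
have t01' : 0 < t < 1.
  by case/andP: tpq => pt tq; rewrite (le_lt_trans p0) // (lt_le_trans tq).
have t01 : 0 <= t <= 1 by case/andP: t01' => /ltW -> /ltW ->.
have dw : cderiv w t (velocity g t) by apply: cderivB_cst; exact: dg.
split; last first.
  apply: is_derive_argument dw (within_continuous_pt t01' ctheta) _.
  by apply: filterS (near_itv t01') => x; exact: wE.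
case: dw => dr di.
have dn2 : is_derive t 1 n2 (2 * (Re (w t) * Re (velocity g t) +
    Im (w t) * Im (velocity g t))).
  rewrite (_ : n2 = (Re \o w) * (Re \o w) + (Im \o w) * (Im \o w)); last first.
    by apply/funext => x; rewrite /n2 !expr2.
  by apply: is_derive_eq; rewrite /GRing.scale /=; ring.
have dl := is_derive1_comp (is_derive1_ln (n20 t t01)) dn2.
rewrite (_ : _ \o _ = (@ln R \o n2) * cst (2^-1)) //.
apply: is_derive_eq; rewrite !ReImE cReV cImV /GRing.scale /= /cst -/(n2 t).
have n := negbT (gt_eqF (n20 t t01)).
by rewrite /w !ReImE; field.
Qed.

End Winding.

(** * Removing the exponential factor by a parameter *)

Section ExponentialPart.
Variable R : realType.
Local Notation mu := (@lebesgue_measure R).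
Local Notation Re := (@complex.Re R).
Local Notation Im := (@complex.Im R).

Lemma normr_Re_cexp (z y : R[i]) :
  `|Re (cexp z * y)| <= expR (Re z) * (`|Re y| + `|Im y|).
Proof.
have -> : Re (cexp z * y) = expR (Re z) * (cos (Im z) * Re y - sin (Im z) * Im y).
  by rewrite /cexp !ReImE /=; ring.
rewrite normrM (ger0_norm (expR_ge0 _)) ler_wpM2l ?expR_ge0 //.
apply: le_trans (ler_normB _ _) _; rewrite !normrM.
by apply: lerD; rewrite ler_piMl // ?cos_max ?sin_max // ler_norml
  ?cos_geN1 ?cos_le1 ?sin_geN1 ?sin_le1.
Qed.

Section Param.
Variables (s : seq R) (h u : R -> R[i]).
Hypotheses (hs : itv_partition 0 1 s) (ch : ccont 0 1 h) (cu : pw_ccont s u).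

Let H (x : R) (t : R) : R[i] := cexp (x%:C * h t) * u t.

Lemma pw_ccont_param x : pw_ccont s (H x).
Proof.
apply: pw_ccontM => //; apply: ccont_pw_ccont => //; apply: ccont_cexp.
by apply: ccontM => //; exact: ccont_cst.
Qed.

Lemma cderiv_param x t : cderiv (fun x => H x t) x (H x t * h t).
Proof.
have c1 : cderiv (fun x : R => x%:C) x 1.
  split; first exact: is_derive_id.
  exact: is_derive_cst.
have := cderivM (cderiv_cexp (cderivM c1 (cderiv_cst (h t) x))) (cderiv_cst (u t) x).
by congr cderiv; rewrite /H; ring.
Qed.

Lemma param_derivative_bound (a : R) : exists2 K, 0 <= K &
  forall x t, a - 1 < x < a + 1 -> 0 <= t <= 1 -> `|Re (H x t * h t)| <= K.
Proof.
have hM := pw_ccontM hs cu (ccont_pw_ccont hs ch).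
have [M1 B1] := pw_cont_bounded hs (pw_ccont_Re hs hM).
have [M2 B2] := pw_cont_bounded hs (pw_ccont_Im hs hM).
have [M3 B3] := within_continuous_bounded ler01 ch.1.
have I0 : 0 <= (0 : R) <= 1 by rewrite lexx ler01.
have := (B1 0 I0, B2 0 I0, B3 0 I0).
move=> [[/(le_trans (normr_ge0 _)) P1 /(le_trans (normr_ge0 _)) P2]
  /(le_trans (normr_ge0 _)) P3].
(* On the window of radius 1 around [a] one has |x| <= |a| + 1; [M3] bounds the real part of [h],
   and [M1], [M2] bound the two components of [u * h]. *)
exists (expR ((`|a| + 1) * M3) * (M1 + M2)).
  by rewrite mulr_ge0 ?expR_ge0 // addr_ge0.
move=> x t xa t01; rewrite /H -mulrA.
apply: le_trans (normr_Re_cexp _ _) _.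
apply: ler_pM; rewrite ?expR_ge0 ?addr_ge0 //; last first.
  by apply: lerD; [exact: B1|exact: B2].
rewrite ler_expR !ReImE /= mul0r subr0 (le_trans (ler_norm _)) // normrM.
apply: ler_pM => //; last exact: B3.
have : `|x - a| <= 1 by rewrite ler_norml; case/andP: xa; lra.
by have := ler_normD (x - a) a; rewrite subrK; lra.
Qed.

(** The local bound justifies differentiation under the integral sign, so the derivative in [x] is
    zero everywhere. The parameters 1 and 0 compare the integrand with and without its
    exponential. *)
Lemma integral_param_cst :
  (forall x, \int[mu]_(t in `[0, 1]) Re (H x t * h t) = 0) ->
  \int[mu]_(t in `[0, 1]) Re (H 1 t) = \int[mu]_(t in `[0, 1]) Re (H 0 t).
Proof.
move=> H0; apply: (is_derive_0_is_cst (f := fun x => \int[mu]_(t in `[0, 1]) Re (H x t))).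
move=> a; have [K K0 HK] := param_derivative_bound a.
pose f x t := Re (H x t).
have pE x t : partial1of2 f x t = Re (H x t * h t).
  by rewrite partial1of2E; have [[_ ->] _] := cderiv_param x t.
have aI : `]a - 1, a + 1[%classic a by rewrite /= in_itv /=; apply/andP; split;
  lra.
have fi x : `]a - 1, a + 1[%classic x -> mu.-integrable `[0, 1] (EFin \o f x).
  by move=> _; apply: pw_cont_integrable hs (pw_ccont_Re hs (pw_ccont_param x)).
have fd x t : `]a - 1, a + 1[%classic x -> `[0, 1]%classic t -> derivable (f^~ t) x 1.
  by move=> _ _; have [[]] := cderiv_param x t.
have Ki : mu.-integrable `[0, 1] (EFin \o (fun=> K)).
  by apply: (pw_cont_integrable hs (pw_ccont_Re hs (pw_ccont_cst hs K%:C))).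
have fb x t : `]a - 1, a + 1[%classic x -> `[0, 1]%classic t -> `|partial1of2 f x t| <= K.
  by rewrite /= !in_itv /= pE; exact: HK.
split; first exact: (derivable_under_integral _ aI fi fd (fun=> K0) Ki fb).
rewrite -derive1E (differentiation_under_integral _ aI fi fd (fun=> K0) Ki fb) //.
by rewrite -[RHS](H0 a); apply: eq_Rintegral => t _; rewrite pE.
Qed.

End Param.

Lemma eq_integral01 (h k : R -> R[i]) :
  (forall t, 0 <= t <= 1 -> h t = k t) -> integral01 h = integral01 k.
Proof.
by move=> hk; congr (_ +i* _); apply: eq_Rintegral => t;
  rewrite inE /= in_itv /= => /hk ->.
Qed.

(** This transfers statements about real parts, such as [integral_param_cst], to imaginary parts. *)
Lemma Im_Re (z : R[i]) : Im z = Re (- 'i * z).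
Proof. by rewrite !ReImE /=; ring. Qed.

Section ClosedCurve.
Variables (g : R -> R[i]) (s : seq R).
Hypotheses (hs : itv_partition 0 1 s) (cg : ccont 0 1 g)
  (vg : pw_ccont s (velocity g))
  (dg : on_pieces
     (fun p q => forall t, p < t < q -> cderiv g t (velocity g t)) 0 s)
  (g01 : g 0 = g 1).

Lemma closed_exp_integral (c a : R[i]) :
  integral01 (fun t => cexp (c * (g t - a)) * velocity g t) = 0.
Proof.
have cw : ccont 0 1 (fun t => g t - a) by exact: ccontB_cst.
have cc : ccont 0 1 (fun t => cexp (c * (g t - a))).
  by apply: ccont_cexp; apply: ccontM => //; exact: ccont_cst.
have Hk : pw_ccont s (fun t => cexp (c * (g t - a)) * velocity g t).
  by apply: pw_ccontM => //; exact: ccont_pw_ccont.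
(* The primitive [cexp (c * (z - a)) / c] requires a nonzero [c]; for [c = 0] the primitive is
   [z - a]. *)
have [c0|c0] := eqVneq c 0.
  rewrite (integral01_FTC hs cw Hk); first by rewrite g01 subrr.
  apply: (on_pieces_imp hs) dg => p q _ _ _ d t /d dt.
  by rewrite c0 mul0r cexp0 mul1r; exact: cderivB_cst.
pose F t := c^-1 * cexp (c * (g t - a)).
have cF : ccont 0 1 F by apply: ccontM => //; exact: ccont_cst.
rewrite (integral01_FTC hs cF Hk); first by rewrite /F g01 subrr.
apply: (on_pieces_imp hs) dg => p q _ _ _ d t /d dt.
have := cderivZ c^-1 (cderiv_cexp (cderivZ c (cderivB_cst a dt))).
by congr cderiv; rewrite mulrCA mulKf.
Qed.

Lemma residue_integral (a L : R[i]) : winds_once_counterclockwise g a ->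
  pw_ccont s (fun t => cexp (L * (g t - a)) * ((g t - a)^-1 * velocity g t)) /\
  integral01 (fun t => cexp (L * (g t - a)) * ((g t - a)^-1 * velocity g t)) =
  0 +i* (2 * pi).
Proof.
move=> wa; have [w0 <-] := winding_integral hs cg vg dg g01 wa.
have cw : ccont 0 1 (fun t => g t - a) by exact: ccontB_cst.
pose h t := L * (g t - a); pose u t := (g t - a)^-1 * velocity g t.
have ch : ccont 0 1 h by apply: ccontM => //; exact: ccont_cst.
have cu : pw_ccont s u by apply: pw_ccontM => //; apply: ccont_pw_ccont => //;
  exact: ccontV.
split; first by apply: pw_ccontM => //; apply: ccont_pw_ccont => //;
  exact: ccont_cexp.
(* The constant [c] handles both components at once: 1 gives the real part and [- 'i] the imaginary
   part. *)
have H c : \int[mu]_(t in `[0, 1]) Re (c * (cexp (h t) * u t)) =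
    \int[mu]_(t in `[0, 1]) Re (c * u t).
  have cuc : pw_ccont s (fun t => c * u t) by apply: pw_ccontM => //;
    exact: pw_ccont_cst.
  transitivity (\int[mu]_(t in `[0, 1]) Re (cexp (1%:C * h t) * (c * u t))).
    by apply: eq_Rintegral => t _; rewrite mul1r mulrCA.
  transitivity (\int[mu]_(t in `[0, 1]) Re (cexp (0%:C * h t) * (c * u t)));
    last first.
    by apply: eq_Rintegral => t _; rewrite mul0r cexp0 mul1r.
  apply: (integral_param_cst hs ch cuc) => x.
  (* Differentiating in [x] brings down [L * (g t - a)], which cancels the pole and leaves a
     multiple of the integral in [closed_exp_integral]. *)
  pose k t := cexp (x%:C * L * (g t - a)) * velocity g t.
  have ck : pw_ccont s k.
    apply: pw_ccontM => //; apply: ccont_pw_ccont => //; apply: ccont_cexp.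
    by apply: ccontM => //; exact: ccont_cst.
  have := integral01Z hs (c * L) ck; rewrite closed_exp_integral mulr0.
  move=> /(congr1 Re) /= E; rewrite -[RHS]E; apply: eq_Rintegral => t.
  rewrite inE /= in_itv /= => /w0 wt; congr Re.
  by rewrite /k /u /h -[x%:C * L * _]mulrA; field.
apply: complex_ext; rewrite /integral01 /=.
  have := H 1; under eq_Rintegral do rewrite mul1r.
  by under [RHS]eq_Rintegral do rewrite mul1r.
by under eq_Rintegral do rewrite /= Im_Re;
  under [RHS]eq_Rintegral do rewrite /= Im_Re.
Qed.

End ClosedCurve.

End ExponentialPart.

(** * Partial fractions and conclusion *)

Lemma partial_fractions (F : fieldType) n (a : 'I_n.+1 -> F) (z : F) :
  injective a -> (forall i, z != a i) ->
  (\prod_i (z - a i))^-1 =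
  \sum_j (\prod_(i < n.+1 | i != j) (a j - a i))^-1 * (z - a j)^-1.
Proof.
move=> ai za.
have c0 j : \prod_(i < n.+1 | i != j) (a j - a i) != 0.
  by apply/prodf_neq0 => i ij; rewrite subr_eq0 (inj_eq ai) eq_sym.
pose c j := (\prod_(i < n.+1 | i != j) (a j - a i))^-1.
pose Q j : {poly F} := \prod_(i < n.+1 | i != j) ('X - (a i)%:P).
(* The sum of the Lagrange basis polynomials at the nodes [a j], minus 1: its size is at most [n.+1]
   and it vanishes at [n.+1] distinct nodes, so it is zero. Its value at [z] gives the claim. *)
pose P : {poly F} := \sum_j c j *: Q j - 1.
have sQ j : (size (Q j) <= n.+1)%N.
  rewrite /Q -big_filter size_prod_XsubC ltnS size_filter.
  rewrite -sum1_count sum1dep_card.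
  by rewrite cardsE (_ : #|_| = n) //; have := cardC1 j; rewrite card_ord.
have P0 : P = 0.
  apply: (@roots_geq_poly_eq0 _ _ [seq a i | i <- enum 'I_n.+1]).
  - apply/allP => y /mapP [j _ ->]; rewrite /root /P hornerD hornerN hornerC.
    rewrite horner_sum (bigD1 j) //= big1 => [|k kj].
      rewrite hornerZ horner_prod addr0.
      under [X in c j * X]eq_bigr do rewrite hornerXsubC.
      by rewrite /c mulVf // subrr.
    rewrite hornerZ horner_prod (bigD1 j) /= 1?eq_sym //.
    by rewrite hornerXsubC subrr mul0r mulr0.
  - by rewrite map_inj_uniq ?enum_uniq.
  rewrite size_map size_enum_ord /P (leq_trans (size_polyD _ _)) //.
  rewrite geq_max size_polyN size_poly1 andbT.
  apply: (leq_trans (size_sum _ _ _)); apply/bigmax_leqP => j _.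
  exact: leq_trans (size_scale_leq _ _) (sQ j).
have z0 : \prod_i (z - a i) != 0 by apply/prodf_neq0 => i _; rewrite subr_eq0.
apply: (mulfI z0); rewrite divff // mulr_sumr.
have : P.[z] = 0 by rewrite P0 horner0.
rewrite /P hornerD hornerN hornerC horner_sum => /eqP.
rewrite subr_eq0 => /eqP P1; rewrite -[LHS]P1; apply: eq_bigr => j _.
rewrite hornerZ horner_prod [in RHS](bigD1 j) //=.
under eq_bigr do rewrite hornerXsubC.
have zj : z - a j != 0 by rewrite subr_eq0.
by rewrite -/(c j); field.
Qed.

Theorem theorem1p1 (R : realType) (N : nat) (hN : (1 <= N)%N)
    (l : 'I_N -> int) (hl : signature l)
    (x lnx : R[i]) (hx0 : x != 0) (hx1 : x != 1) (hlnx : cexp lnx = x)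
    (C : R -> R[i]) (hC : contour C)
    (hsing : forall i : 'I_N, encloses C (shifted l i)%:~R) :
  normalized_schur l [tuple x] =
    ((N - 1)`!)%:R / (x - 1) ^+ (N - 1) *
    (1 / (2%:R * (pi : R)%:C * (0 +i* 1)) *
     contour_integral C
       (fun z => cpow lnx z / \prod_(i < N) (z - (shifted l i)%:~R))).
Proof.
case: N hN l hl hsing => // n _ l hl hsing.
have [pC [g01 _] pos] := hC.
have [s [hs cg vg dg]] := piecewise_C1_pw pC.
pose a j : R[i] := (shifted l j)%:~R.
have ai : injective a by move=> i j /intr_inj /(shifted_inj hl).
(* Positive orientation gives winding number one around each enclosed pole; this also keeps the
   curve away from the poles. *)
have w j : winds_once_counterclockwise C (a j) := pos _ (hsing j).
pose c j := (\prod_(i < n.+1 | i != j) (a j - a i))^-1.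
pose h j t := cexp (lnx * (C t - a j)) * ((C t - a j)^-1 * velocity C t).
have res j := residue_integral hs cg vg dg g01 lnx (w j).
have -> : contour_integral C (fun z => cpow lnx z / \prod_(i < n.+1) (z - a i)) =
    \sum_j (c j * x ^ shifted l j) * (0 +i* (2 * pi)).
  transitivity (integral01 (fun t => \sum_j (c j * x ^ shifted l j) * h j t)).
    apply: eq_integral01 => t t01.
    rewrite partial_fractions // => [|j]; last first.
      by have [w0 _] := winding_integral hs cg vg dg g01 (w j);
        rewrite -subr_eq0 w0.
    rewrite mulr_sumr mulr_suml; apply: eq_bigr => j _.
    (* Centring the exponential at the pole splits off the factor [x ^ shifted l j], which is the
       numerator of the residue, and leaves the integrand of [residue_integral]. *)
    have -> : cpow lnx (C t) = x ^ shifted l j * cexp (lnx * (C t - a j)).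
      by rewrite -hlnx -cexp_intmul -cexpD -/(a j); congr cexp; ring.
    by rewrite /h /c; ring.
  rewrite (integral01_sum hs _ _ (fun j => (res j).1)).2.
  by apply: eq_bigr => j _; rewrite (res j).2.
have p0 : 0 +i* (2 * pi) != 0 :> R[i].
  by rewrite eq_complex /= eqxx mulf_eq0 !gt_eqF ?pi_gt0 // ltr0n.
have -> : 2%:R * pi%:C * (0 +i* 1) = 0 +i* (2 * pi) :> R[i].
  by apply: complex_ext; rewrite !ReImE /=; ring.
rewrite -mulr_suml normalized_schurE // subn1 /=; congr (_ * _).
rewrite div1r mulrC mulfK //; apply: eq_bigr => j _.
by rewrite mulrC.
Qed.
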